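(* For every graph $H$ with at least one edge there exists a constant $C=C(H)$ such that for every $\eta>0$ there exists an integer $n_0=n_0(H,\eta)$ such that for every $n\ge n_0$, $$2\left(1-\frac{1}{\chi'_{\rm Ore}(H)}\right)n-C\;\le\;\delta'_{\rm Ore}(H,n)\;\le\;2\left(1-\frac{1}{\chi'_{\rm Ore}(H)}+\eta\right)n .$$
   Context: All graphs are finite and simple; $d(x)$ is the degree of $x$ and $H[N(x)]$ the subgraph of $H$ induced by the neighbourhood of $x$. Copies of $H$ are not necessarily induced subgraphs. $\delta'_{\rm Ore}(H,n)$ denotes the smallest integer $k$ such that whenever $w$ is a vertex of a graph $G$ of order $n$ with $d(x)+d(y)\ge k$ for all non-adjacent $x\ne y\in V(G)$, then $G$ contains a copy of $H$ covering $w$. Colour extension number: let $r:=\chi(H)$. For a vertex $x$ of $H$ with $\chi(H[N(x)])\le r-2$, let $m_x$ be the smallest integer for which there is a proper $(r-2)$-colouring of $H[N(x)]$ that can be extended to a proper $(r+m_x)$-colouring of $H$ (colourings need not use all available colours; the colours of the $(r-2)$-colouring are among the $r+m_x$ colours). Put $CE(H):=\min\{m_x : x\in V(H),\ \chi(H[N(x)])\le r-2\}$, and $CE(H):=\infty$ if $\chi(H[N(x)])=r-1$ for all $x\in V(H)$. Define $\chi'_{\rm Ore}(H):=\chi(H)$ if $CE(H)=\infty$, and $\chi'_{\rm Ore}(H):=\chi(H)-\frac{2}{CE(H)+2}$ otherwise. *)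

(* Defs.v *)
From HB Require Import structures.
From mathcomp Require Import all_boot all_order all_algebra.
From mathcomp Require Import reals.

Set Implicit Arguments.
Unset Strict Implicit.
Unset Printing Implicit Defensive.

Import Order.TTheory GRing.Theory Num.Theory.

Record sgraph := SGraph {
  vertex :> finType;
  edge : rel vertex;
  edge_sym : symmetric edge;
  edge_irr : irreflexive edge
}.

Definition has_edge (G : sgraph) : Prop := exists x y : G, edge x y.

Definition nbhd (G : sgraph) (x : G) : {set G} := [set y | edge x y].

Definition deg (G : sgraph) (x : G) : nat := #|nbhd x|.

Section Induced.
Variables (G : sgraph) (A : {set G}).

Definition induced_edge : rel {x : G | x \in A} :=
  fun u v => edge (val u) (val v).

Lemma induced_edge_sym : symmetric induced_edge.
Proof. by move=> u v; apply: edge_sym. Qed.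

Lemma induced_edge_irr : irreflexive induced_edge.
Proof. by move=> u; apply: edge_irr. Qed.

Definition induced : sgraph := SGraph induced_edge_sym induced_edge_irr.
End Induced.

Definition proper_coloring (G : sgraph) (k : nat) (c : {ffun G -> 'I_k}) : bool :=
  [forall x, forall y, edge x y ==> (c x != c y)].

Definition colorable (G : sgraph) (k : nat) : bool :=
  [exists c : {ffun G -> 'I_k}, proper_coloring c].

Lemma colorable_card (G : sgraph) : exists k, colorable G k.
Proof.
exists #|G|; apply/existsP; exists [ffun x => enum_rank x].
apply/forallP=> x; apply/forallP=> y; apply/implyP=> xy.
rewrite !ffunE (inj_eq enum_rank_inj).
by apply: contraTneq xy => ->; rewrite edge_irr.
Qed.

Definition chi (G : sgraph) : nat := ex_minn (colorable_card G).

(* Vertices x with chi(H[N(x)]) <= chi(H) - 2, stated without truncated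
   subtraction. *)
Definition low_vertex (H : sgraph) : finType :=
  {x : H | chi (induced (nbhd x)) + 2 <= chi H}.

(* Some proper (r-2)-colouring of H[N(x)] extends to a proper (r+m)-colouring
   of H, where r = chi(H); the colours 0, ..., r-3 of the former are
   identified with the first r-2 colours of the latter. *)
Definition extendable (H : sgraph) (x : H) (m : nat) : bool :=
  [exists c0 : {ffun induced (nbhd x) -> 'I_(chi H - 2)},
   exists c : {ffun H -> 'I_(chi H + m)},
    [&& proper_coloring c0, proper_coloring c &
        [forall u, c (val u) == c0 u :> nat]]].

Lemma low_vertex_extendable (H : sgraph) (x : low_vertex H) :
  exists m, extendable (val x) m.
Proof.
case: x => x /= lowx; exists (chi H).
have colchi G : colorable G (chi G) by rewrite /chi; case: ex_minnP.
have /existsP[c0 /forallP pc0] := colchi (induced (nbhd x)).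
have /existsP[c1 /forallP pc1] := colchi H.
have le0 : chi (induced (nbhd x)) <= chi H - 2.
  by have := leq_sub2r 2 lowx; rewrite addnK.
have lt0 (u : induced (nbhd x)) : c0 u < chi H + chi H.
  apply: (leq_trans (ltn_ord _)); apply: (leq_trans le0).
  by apply: (leq_trans (leq_subr _ _)); rewrite leq_addr.
have lt1 (u : H) : chi H + c1 u < chi H + chi H by rewrite ltn_add2l.
pose c (u : H) : 'I_(chi H + chi H) :=
  if insub u is Some v then Ordinal (lt0 v) else Ordinal (lt1 u).
have ltc0 (u : induced (nbhd x)) : c0 u < chi H.
  apply: (leq_trans (ltn_ord _)); apply: (leq_trans le0); exact: leq_subr.
apply/existsP; exists [ffun u => widen_ord le0 (c0 u)].
apply/existsP; exists [ffun u => c u]; apply/and3P; split.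
- apply/forallP=> u; apply/forallP=> v; apply/implyP=> uv; rewrite !ffunE.
  by have /forallP/(_ v)/implyP/(_ uv) := pc0 u.
- apply/forallP=> u; apply/forallP=> v; apply/implyP=> uv.
  rewrite !ffunE -val_eqE /c.
  case: insubP => [u' _ eu|_]; case: insubP => [v' _ ev|_] /=.
  + have uv' : @edge (induced (nbhd x)) u' v' by rewrite /= /induced_edge eu ev.
    by have /forallP/(_ v')/implyP/(_ uv') := pc0 u'.
  + by rewrite ltn_eqF // (leq_trans (ltc0 _)) // leq_addr.
  + by rewrite gtn_eqF // (leq_trans (ltc0 _)) // leq_addr.
  + rewrite eqn_add2l; by have /forallP/(_ v)/implyP/(_ uv) := pc1 u.
- by apply/forallP=> u; rewrite !ffunE /c valK.
Qed.

(* m_x; a negative m_x is impossible, as H has no proper colouring with fewer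
   than chi(H) colours. *)
Definition ext_number (H : sgraph) (x : low_vertex H) : nat :=
  ex_minn (low_vertex_extendable x).

(* CE(H), with None standing for infinity. *)
Definition CE (H : sgraph) : option nat :=
  if [pick x : low_vertex H] is Some x0
  then Some (ext_number [arg min_(x < x0) ext_number x])
  else None.

Local Open Scope ring_scope.

Definition chi_Ore (R : realType) (H : sgraph) : R :=
  if CE H is Some m then (chi H)%:R - 2 / (m%:R + 2) else (chi H)%:R.

Definition covering_copy (H G : sgraph) (w : G) : Prop :=
  exists f : H -> G,
    [/\ injective f,
        forall x y : H, edge x y -> edge (f x) (f y)
      & exists x : H, f x = w].

Definition Ore_forces (H : sgraph) (n : nat) (k : int) : Prop :=
  forall (G : sgraph) (w : G), #|G| = n ->
    (forall x y : G, x != y -> ~~ edge x y -> k <= (deg x + deg y)%:Z) ->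
    covering_copy H w.

(* The least such k is unique when it exists; it does not exist when
   0 < n < #|H| (no k works) or n = 0 (every k works). *)
Definition is_delta_Ore (H : sgraph) (n : nat) (k : int) : Prop :=
  Ore_forces H n k /\ forall k' : int, Ore_forces H n k' -> k <= k'.

(* Main.v *)
Require Import Defs.
From HB Require Import structures.
From mathcomp Require Import all_boot all_order all_algebra.
From mathcomp Require Import reals.
From mathcomp Require Import boolp zify ring lra.

Set Implicit Arguments.
Unset Strict Implicit.
Unset Printing Implicit Defensive.

Import Order.TTheory GRing.Theory Num.Theory.
Local Open Scope ring_scope.

(* Upper bound. Write c = 1/chi'_Ore(H), r = chi(H), n = |G| and let the degree
   sums be at least 2(1 - c + eta)n. The vertices of degree < (1 - c + eta)n form
   a clique L; if L meets N(w) in |H| vertices we are done. Otherwise nearly all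
   vertices of N(w) miss at most (c - eta)n others, and classes of a blown-up
   complete graph are chosen greedily in N(w). If r - 1 classes fit in N(w), an
   r-th one exists in G and H embeds with any vertex mapped to w. Otherwise
   d(w) < (r - 2)cn or so, hence CE(H) = m is finite and the non-neighbours of w
   have degree at least about (2 - rc)n: starting from r - 2 classes in N(w), the
   greedy choice continues outside N(w) up to r + m classes, which contain H with
   the vertex attaining CE(H) mapped to w.
   Lower bound. Take r - 2 independent classes of size about cn, all joined to w,
   and a complete multipartite graph on the remaining vertices, not joined to w,
   with m + 1 classes (or with singleton classes, if CE(H) is infinite). *)

(** * Colourings and the chromatic number *)

Lemma colorableP (G : sgraph) (k : nat) :
  reflect (exists c : G -> nat, (forall x, (c x < k)%N) /\
             (forall x y : G, edge x y -> c x != c y)) (colorable G k).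
Proof.
apply: (iffP existsP) => [[c /forallP pc]|[c [ltc pc]]].
  exists (fun x => c x : nat); split=> [x|x y xy] //.
  by have /forallP/(_ y)/implyP/(_ xy) := pc x.
exists [ffun x => Ordinal (ltc x)].
apply/forallP=> x; apply/forallP=> y; apply/implyP=> xy.
by rewrite !ffunE -val_eqE /= pc.
Qed.

Lemma colorable_chi (G : sgraph) : colorable G (chi G).
Proof. by rewrite /chi; case: ex_minnP. Qed.

Lemma chi_leq (G : sgraph) (k : nat) : colorable G k -> (chi G <= k)%N.
Proof. by rewrite /chi; case: ex_minnP => c _; apply. Qed.

Lemma chi_gt1 (H : sgraph) : has_edge H -> (1 < chi H)%N.
Proof.
case=> x [y xy]; have /colorableP[c [ltc /(_ x y xy)]] := colorable_chi H.
by have := ltc x; have := ltc y; case: (chi H) => [|[|k]] //; lia.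
Qed.

(** * Copies of [H] in prescribed vertex classes *)

Lemma ltn_nth_enum (T : finType) (A : {set T}) (z : T) (i : nat) :
  (i < #|A|)%N -> nth z (enum A) i \in A.
Proof. by move=> ltiA; rewrite -mem_enum mem_nth // -cardE. Qed.

(** Vertices of [H] sharing a class get distinct positions in it through [enum_rank], and [x] is
    sent to [w]. Allowing equal classes makes this apply to cliques as well as to multipartite
    graphs. *)
Lemma embed_classes (H G : sgraph) (w : G) (x : H) (B : H -> {set G}) :
  (forall y, #|H| <= #|B y|)%N ->
  (forall y, w \notin B y) ->
  (forall y y', B y = B y' \/ [disjoint B y & B y']) ->
  (forall y y', edge y y' -> forall z z', z \in B y -> z' \in B y' ->
     z != z' -> edge z z') ->
  (forall y, edge x y -> B y \subset nbhd w) ->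
  covering_copy H w.
Proof.
move=> leHB wB disjB edgeB nbB.
pose g y := nth w (enum (B y)) (enum_rank y).
have ltg y : (enum_rank y < #|B y|)%N.
  by apply: leq_trans (leHB y); apply: ltn_ord.
have gB y : g y \in B y by apply: ltn_nth_enum.
have gw y : g y != w by apply: contraNneq (wB y) => <-.
have injg : injective g.
  move=> y y' eg; case: (disjB y y') => [eB|dB].
    apply: enum_rank_inj; apply/val_inj/eqP.
    have := nth_uniq w (s := enum (B y)) (i := enum_rank y) (j := enum_rank y').
    rewrite -cardE {2}eB => <-; rewrite ?ltg ?enum_uniq //.
    by move: eg; rewrite /g -eB => ->.
  by move: (disjointFr dB (gB y)); rewrite eg gB.
have xg y : edge x y -> edge w (g y).
  by move=> xy; have /subsetP/(_ _ (gB y)) := nbB y xy; rewrite inE.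
exists (fun y => if y == x then w else g y); split; last by exists x; rewrite eqxx.
- move=> y y'; case: (eqVneq y x) => [->|_]; case: (eqVneq y' x) => [->|_] //; last exact: injg.
    by move/esym/eqP; rewrite (negPf (gw y')).
  by move/eqP; rewrite (negPf (gw y)).
- move=> y y' yy'; case: eqP => [ey|_]; case: eqP => [ey'|_].
  + by move: yy'; rewrite ey ey' edge_irr.
  + by apply: xg; rewrite -ey.
  + by rewrite edge_sym; apply: xg; rewrite -ey' edge_sym.
  + apply: (edgeB _ _ yy') => //; apply: contraTneq yy' => /injg ->.
    by rewrite edge_irr.
Qed.

Lemma embed_clique (H G : sgraph) (w : G) (x : H) (K : {set G}) :
  (#|H| <= #|K|)%N -> K \subset nbhd w ->
  (forall z z', z \in K -> z' \in K -> z != z' -> edge z z') ->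
  covering_copy H w.
Proof.
move=> leHK Kw cliqueK; apply: (@embed_classes H G w x (fun=> K)) => //.
- by move=> _; apply/negP=> /(subsetP Kw); rewrite inE edge_irr.
- by move=> *; left.
Qed.

(** Classes may contain edges of their own: this is a complete multipartite subgraph, not an induced
    one. Disjointness follows from irreflexivity of [edge]. *)
Definition multipartite (G : sgraph) (j t : nat) (U : nat -> {set G}) : Prop :=
  (forall i, (i < j)%N -> (t <= #|U i|)%N) /\
  (forall i i', (i < j)%N -> (i' < j)%N -> i != i' ->
     forall x y, x \in U i -> y \in U i' -> edge x y).

Lemma multipartite_disjoint (G : sgraph) (j t : nat) (U : nat -> {set G}) i i' :
  multipartite j t U -> (i < j)%N -> (i' < j)%N -> i != i' ->
  [disjoint U i & U i'].
Proof.
move=> [_ Uedge] ltij lti'j neq; rewrite -setI_eq0.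
apply/eqP/setP=> z; rewrite !inE; apply/negbTE/negP=> /andP[zi zi'].
by have := Uedge _ _ ltij lti'j neq z z zi zi'; rewrite edge_irr.
Qed.

(** Class size [#|H|.+1] leaves [#|H|] vertices once [w] is deleted. *)
Lemma embed_multipartite (H G : sgraph) (w : G) (x : H) (c : H -> nat)
    (s : nat) (U : nat -> {set G}) :
  multipartite s #|H|.+1 U ->
  (forall y, c y < s)%N -> (forall y y' : H, edge y y' -> c y != c y') ->
  (forall y, edge x y -> U (c y) \subset nbhd w) ->
  covering_copy H w.
Proof.
move=> mU ltc pc xU; have [cardU edgeU] := mU.
apply: (@embed_classes H G w x (fun y => U (c y) :\ w)).
- by move=> y; have := cardU _ (ltc y); rewrite (cardsD1 w); case: (_ \in _); lia.
- by move=> y; rewrite !inE eqxx.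
- move=> y y'; case: (eqVneq (c y) (c y')) => [->|neq]; first by left.
  right; apply: disjointWl (subsetDl _ _) _; apply: disjointWr (subsetDl _ _) _.
  exact: multipartite_disjoint mU _ _ neq.
- move=> y y' yy' z z'; rewrite !inE => /andP[_ zU] /andP[_ zU'] _.
  exact: edgeU (ltc y) (ltc y') (pc _ _ yy') _ _ zU zU'.
- by move=> y xy; apply: subset_trans (subsetDl _ _) (xU y xy).
Qed.

(** * Growing complete multipartite subgraphs *)

Lemma subset_card_exists (T : finType) (A : {set T}) (k : nat) :
  (k <= #|A|)%N -> exists B : {set T}, B \subset A /\ #|B| = k.
Proof.
move=> /card_geqP[s [us ss sA]]; exists [set z in s]; split.
  by apply/subsetP=> z; rewrite inE => /sA.
by rewrite cardsE; apply/eqP; rewrite -ss; apply/eqP/card_uniqP.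
Qed.

Lemma pigeonhole_fiber (T S : finType) (p : T -> S) (A : {set T})
    (W : {set S}) (k : nat) :
  (forall z, z \in A -> p z \in W) -> (#|W| * k < #|A|)%N ->
  exists2 v, v \in W & (k < #|[set z in A | p z == v]|)%N.
Proof.
move=> pW ltWA; apply/exists_inP; apply: contraLR ltWA.
rewrite negb_exists_in -leqNgt => /forall_inP small.
rewrite -sum1_card (partition_big p (mem W)) //=.
rewrite -sum_nat_const leq_sum // => v vW.
by rewrite sum1dep_card leqNgt small.
Qed.

(** The arithmetic of [multipartite_extend]: [z] candidates, [g] of them good, [n] vertices, old
    classes of size [b]; a bad candidate misses at least [b - a] vertices of some class. *)
Lemma averaging_bound (R : realType) (z g n a b e : R) :
  0 < e -> 0 <= a -> 0 <= n -> 0 <= g -> z <= n -> a < b -> 2 * a < e * b ->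
  (b - a) * (z - g) <= b * (z - e * n) -> e / 2 * n <= g.
Proof.
move=> e0 a0 n0 g0 zn ab ae h; rewrite leNgt; apply/negP => gn.
have n1 : 0 < n.
  by rewrite lt_neqAle n0 andbT; apply: contraTneq gn => <-; rewrite mulr0 -leNgt.
have h1 : (b - a) * (z - e / 2 * n) <= (b - a) * (z - g).
  by apply: ler_wpM2l; lra.
have h2 : a * z <= a * n by apply: ler_wpM2l.
have h3 : 2 * a * n < e * b * n by rewrite ltr_pM2r.
have h4 : 0 <= a * e * n by rewrite !mulr_ge0 // ltW.
lra.
Qed.

(* Double counting the non-adjacent pairs in U x Z, most z in Z are adjacent to
   at least t vertices of every U i; by pigeonhole, t of these z have the same
   neighbours in the union of the U i. *)
Lemma multipartite_extend (R : realType) (eps : R) (j t : nat) :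
  0 < eps -> exists T n0 : nat, forall (G : sgraph), (n0 <= #|G|)%N ->
  forall (U : nat -> {set G}) (mu : nat -> R) (Z : {set G}),
  multipartite j T U ->
  (forall i x, (i < j)%N -> x \in U i -> #|~: nbhd x|%:R <= mu i * #|G|%:R) ->
  (\sum_(i < j) mu i + eps) * #|G|%:R <= #|Z|%:R ->
  exists U' : nat -> {set G}, [/\ multipartite j.+1 t U',
    forall i, (i < j)%N -> U' i \subset U i & U' j \subset Z].
Proof.
move=> eps0.
(* This makes [2 t < eps T], as [averaging_bound] requires. Below, [M] is [t] times the largest
   possible number of traces on [j] sets of size [T]. *)
pose T := (t + Num.truncn (2 * t%:R / eps)).+1.
have ltT : 2 * t%:R / eps < T%:R.
  by apply: lt_le_trans (truncnS_gt _) _; rewrite ler_nat ltnS leq_addl.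
have tT : (t < T)%N by rewrite ltnS leq_addr.
clearbody T.
pose M := (2 ^ (j * T) * t)%N.
pose n0 := (Num.truncn (2 * M%:R / eps)).+1.
exists T, n0 => G leG U mu Z mU missU sumZ.
have [cardU edgeU] := mU.
have nM : M%:R < eps / 2 * #|G|%:R.
  have : 2 * M%:R / eps < #|G|%:R.
    by apply: lt_le_trans (truncnS_gt _) _; rewrite ler_nat.
  by rewrite ltr_pdivrMr // => ?; lra.
have /choice[V VP] : forall i, exists V : {set G},
    (i < j)%N -> V \subset U i /\ #|V| = T.
  move=> i; case: (ltnP i j) => ij; last by exists set0.
  by have [V] := subset_card_exists (cardU i ij); exists V.
pose W := \bigcup_(i < j) V i.
have cardW : (#|W| <= j * T)%N.
  rewrite /W -[X in (_ <= X * _)%N]card_ord -sum_nat_const.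
  elim/big_rec2: _ => [|i a B _ IH]; first by rewrite cards0.
  by rewrite cardsU (leq_trans (leq_subr _ _)) // leq_add // (VP i (ltn_ord i)).2.
pose good := [set z in Z | [forall i : 'I_j, t <= #|nbhd z :&: V i|]%N].
pose wt (z : G) := (\sum_(i < j) #|V i :\: nbhd z|)%N.
have bad_wt z : z \in Z :\: good -> (T - t <= wt z)%N.
  rewrite !inE negb_and => /andP[/orP[/negP//|]]; rewrite negb_forall.
  case/existsP=> i; rewrite -ltnNge => few _.
  rewrite /wt (bigD1 i) //= (leq_trans _ (leq_addr _ _)) //.
  by have := cardsID (nbhd z) (V i); rewrite setIC (VP i (ltn_ord i)).2; lia.
have sum_wt : (\sum_(z in Z) wt z <= \sum_(i < j) \sum_(u in V i) #|~: nbhd u|)%N.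
  rewrite /wt exchange_big leq_sum // => i _ /=.
  under eq_bigr do rewrite -sum1_card big_mkcond /=.
  rewrite exchange_big (bigID (mem (V i))) /= addnC big1 ?add0n; last first.
    by move=> u /negPf uV; apply: big1 => z _; rewrite !inE uV andbF.
  apply: leq_sum => u uV; rewrite -sum1_card -big_mkcondr /=.
  rewrite [leqRHS]big_mkcond [leqLHS]big_mkcond leq_sum // => z _.
  by rewrite !inE uV andbT edge_sym; case: (z \in Z); case: (edge _ _).
have few_bad : (T - t)%:R * #|Z :\: good|%:R <= T%:R * (#|Z|%:R - eps * #|G|%:R) :> R.
  apply: (@le_trans _ _ (\sum_(z in Z) wt z)%:R).
    rewrite -natrM ler_nat mulnC -sum_nat_const.
    rewrite [leqRHS](big_setID good) /= (leq_trans _ (leq_addl _ _)) //.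
    by rewrite leq_sum // => z zb; apply: bad_wt.
  apply: (@le_trans _ _ (\sum_(i < j) (mu i * #|G|%:R) *+ T)).
    apply: (@le_trans _ _ (\sum_(i < j) \sum_(u in V i) #|~: nbhd u|)%:R).
      by rewrite ler_nat.
    rewrite natr_sum; apply: ler_sum => i _; rewrite natr_sum.
    have [VU cV] := VP i (ltn_ord i); rewrite -cV -sumr_const.
    by apply: ler_sum => u uV; apply: missU (subsetP VU _ uV).
  rewrite sumrMnl -mulr_suml mulr_natl lerMn2r.
  by apply/orP; right; move: sumZ; rewrite mulrDl => ?; lra.
have many_good : (M < #|good|)%N.
  rewrite -(ltr_nat R); apply: lt_le_trans nM _.
  have cZ : #|Z :\: good|%:R = #|Z|%:R - #|good|%:R :> R.
    rewrite -(cardsID good Z) natrD.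
    have -> : Z :&: good = good by apply/setP=> z; rewrite !inE andbA andbb.
    by ring.
  have leZ : #|Z|%:R <= #|G|%:R :> R by rewrite ler_nat max_card.
  move: few_bad; rewrite cZ natrB ?(ltnW tT) //.
  have : 2 * t%:R < eps * T%:R by move: ltT; rewrite ltr_pdivrMr // [ltRHS]mulrC.
  have : t%:R < T%:R :> R by rewrite ltr_nat.
  move=> ltab ltae h; apply: (averaging_bound eps0 _ _ _ leZ ltab ltae h) => //.
have [||v vW big_fib] := @pigeonhole_fiber _ _ (fun z => nbhd z :&: W) good (powerset W) t.
- by move=> z _; rewrite inE subsetIr.
- apply: leq_ltn_trans many_good; rewrite card_powerset leq_mul2r.
  by rewrite leq_exp2l // cardW orbT.
set Z' := [set z in good | _] in big_fib.
have [z0 z0Z'] : exists z, z \in Z' by apply/set0Pn; rewrite -card_gt0; lia.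
have Zv z i : z \in Z' -> (i < j)%N -> nbhd z :&: V i = v :&: V i.
  rewrite inE => /andP[_ /eqP <-] ij; rewrite -setIA; congr (_ :&: _).
  by apply/esym/setIidPr; apply: (bigcup_sup (Ordinal ij)).
have edgeZ z i u : z \in Z' -> (i < j)%N -> u \in v :&: V i -> edge z u.
  by move=> zZ ij; rewrite -(Zv z) // inE => /andP[]; rewrite inE.
have vU i : (i < j)%N -> v :&: V i \subset U i.
  by move=> ij; apply: subset_trans (subsetIr _ _) (VP i ij).1.
(* The fibre is the new class; each old class shrinks to the trace shared by all of [Z'], which is
   large because members of [Z'] are good. *)
exists (fun i => if i == j then Z' else v :&: V i); split.
- split=> [i|i i'].
    rewrite ltnS leq_eqVlt; case: eqVneq => [_ _|_ /= ij]; first exact: ltnW.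
    rewrite -(Zv z0) //; move: z0Z'; rewrite !inE => /andP[/andP[_ /forallP]].
    by move/(_ (Ordinal ij)).
  have ltj k : (k < j.+1)%N -> k != j -> (k < j)%N.
    by rewrite ltnS leq_eqVlt; case: eqVneq.
  move=> /ltj ij /ltj i'j; case: (eqVneq i j) ij => [->|_] ij;
    case: (eqVneq i' j) i'j => [->|_] i'j //.
  + by move=> _ x y xZ yV; apply: edgeZ yV; last exact: i'j.
  + by move=> _ x y xV yZ; rewrite edge_sym; apply: edgeZ xV; last exact: ij.
  + move=> neq x y xV yV; have {}ij := ij isT; have {}i'j := i'j isT.
    exact: edgeU ij i'j neq _ _ (subsetP (vU i ij) _ xV) (subsetP (vU i' i'j) _ yV).
- by move=> i ij; rewrite ltn_eqF //; apply: vU.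
- by rewrite eqxx; apply/subsetP=> z; rewrite !inE => /andP[/andP[]].
Qed.

(** Each class already found costs at most [mu * #|G|] of [N], so [multipartite_extend] applies at
    every step. Extending shrinks the old classes, hence the induction quantifies over [t]. *)
Lemma multipartite_within (R : realType) (mu eps : R) (p t : nat) : 0 < eps ->
  exists n0 : nat, forall G : sgraph, (n0 <= #|G|)%N ->
  forall N : {set G},
  (forall x, x \in N -> #|~: nbhd x|%:R <= mu * #|G|%:R) ->
  (forall i, (i < p)%N -> (i%:R * mu + eps) * #|G|%:R <= #|N|%:R) ->
  exists U, multipartite p t U /\ forall i, (i < p)%N -> U i \subset N.
Proof.
move=> eps0; elim: p t => [|p IHp] t.
  by exists 0%N => G _ N _ _; exists (fun=> set0); do !split.
have [T [n1 ext]] := multipartite_extend p t eps0.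
have [n2 wit] := IHp T.
exists (maxn n1 n2) => G; rewrite geq_max => /andP[ln1 ln2] N missN sumN.
have [|U [mU UN]] := wit G ln2 N missN; first by move=> i ip; apply/sumN/ltnW.
have [|| U' [mU' U'U U'N]] := ext G ln1 U (fun=> mu) N mU.
- by move=> i x ip xU; apply: missN; apply: subsetP (UN i ip) _ xU.
- by rewrite sumr_const card_ord -[mu *+ p]mulr_natl sumN.
exists U'; split=> // i; rewrite ltnS leq_eqVlt => /orP[/eqP->//|ip].
exact: subset_trans (U'U i ip) (UN i ip).
Qed.

Lemma multipartite_weaken (G : sgraph) (j j' t t' : nat) (U : nat -> {set G}) :
  (j' <= j)%N -> (t' <= t)%N -> multipartite j t U -> multipartite j' t' U.
Proof.
move=> jj tt [cU eU]; split=> [i ij|i i' ij ij'].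
  by apply: leq_trans tt (cU _ _); apply: leq_trans jj.
by apply: eU; [apply: leq_trans ij jj | apply: leq_trans ij' jj].
Qed.

(* Each new class is taken in N :|: A and halved into its parts in N and A. *)
Lemma multipartite_alternative (R : realType) (mu nu eps : R) (p q t : nat) :
  0 < eps ->
  exists n0 : nat, forall G : sgraph, (n0 <= #|G|)%N ->
  forall N A : {set G},
  (forall x, x \in N -> #|~: nbhd x|%:R <= mu * #|G|%:R) ->
  (forall x, x \in A -> #|~: nbhd x|%:R <= nu * #|G|%:R) ->
  (forall i, (i < p)%N -> (i%:R * mu + eps) * #|G|%:R <= #|N|%:R) ->
  (forall i, (i < q)%N ->
     (p%:R * mu + i%:R * nu + eps) * #|G|%:R <= #|N :|: A|%:R) ->
  (exists U, multipartite p.+1 t U /\ forall i, (i < p.+1)%N -> U i \subset N) \/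
  (exists U, [/\ multipartite (p + q) t U,
     forall i, (i < p)%N -> U i \subset N &
     forall i, (p <= i < p + q)%N -> U i \subset A]).
Proof.
move=> eps0; elim: q t => [|q IHq] t.
  have [n0 wit] := multipartite_within mu p t eps0.
  exists n0 => G lG N A missN _ sumN _; right.
  have [U [mU UN]] := wit G lG N missN sumN.
  by exists U; split; rewrite ?addn0 // => i /andP[]; lia.
have [T [n1 ext]] := multipartite_extend (p + q) (t + t) eps0.
(* Size [t] is what the first alternative must pass on, size [T] what the extension consumes. *)
have [n2 alt] := IHq (t + T)%N.
exists (maxn n1 n2) => G; rewrite geq_max => /andP[ln1 ln2] N A missN missA sumN sumA.
have [|[U [mU UN]]|[U [mU UN UA]]] := alt G ln2 N A missN missA sumN.
- by move=> i iq; apply/sumA/ltnW.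
- by left; exists U; split=> //; apply: multipartite_weaken mU; rewrite ?leq_addr.
have mUT : multipartite (p + q) T U by apply: multipartite_weaken mU; rewrite ?leq_addl.
have [|| U' [[cU' eU'] U'U U'Z]] :=
  ext G ln1 U (fun i => if (i < p)%N then mu else nu) (N :|: A) mUT.
- move=> i x ip xU; case: ltnP => pi; first by apply: missN; apply: subsetP (UN _ _) _ xU.
  by apply: missA; apply: subsetP (UA _ _) _ xU; rewrite pi.
- rewrite big_split_ord /=.
  under eq_bigr do rewrite ltn_ord.
  under [X in _ + X + _]eq_bigr do rewrite ltnNge leq_addr /=.
  by rewrite !sumr_const !card_ord -[mu *+ p]mulr_natl -[nu *+ q]mulr_natl sumA.
have tcard : (t <= #|U' (p + q)%N :&: N|)%N || (t <= #|U' (p + q)%N :&: A|)%N.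
  have : (t + t <= #|U' (p + q)%N|)%N by apply: cU'.
  rewrite -{1}(setIidPl U'Z) setIUr cardsU.
  by move=> ?; apply/orP; have [?|?] := leqP t #|U' (p + q)%N :&: N|; [left|right; lia].
(* The chosen half becomes class [k]: for [k = p] it replaces the classes in [A], for [k = p + q] it
   is appended. Below, [pi] recovers the original index. *)
pose last k B i := if i == k then U' (p + q)%N :&: B else U' i.
have mlast k B : (k <= p + q)%N -> (t <= #|U' (p + q)%N :&: B|)%N ->
    multipartite k.+1 t (last k B).
  move=> kpq tB; pose pi i := if i == k then (p + q)%N else i.
  have lastU i : last k B i \subset U' (pi i).
    by rewrite /last /pi; case: eqP => // _; apply: subsetIl.
  have ltpi i : (i < k.+1)%N -> (pi i < (p + q).+1)%N.
    by rewrite /pi; case: eqP => // _; lia.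
  split=> [i ik|i i' ik i'k neq x y xU yU].
    rewrite /last; case: eqP => // _.
    by apply: leq_trans (leq_addr t t) (cU' i _); lia.
  apply: (eU' _ _ (ltpi i ik) (ltpi i' i'k)) (subsetP (lastU i) _ xU)
    (subsetP (lastU i') _ yU).
  by rewrite /pi; case: (eqVneq i k); case: (eqVneq i' k); lia.
have U'N i : (i < p)%N -> U' i \subset N.
  by move=> ip; apply: subset_trans (U'U _ _) (UN _ ip); lia.
case/orP: tcard => [tN|tA].
  left; exists (last p N); split=> [|i]; first by apply: mlast; rewrite ?leq_addr.
  by rewrite ltnS leq_eqVlt /last; case: eqP => //= _ *; [apply: subsetIr|apply: U'N].
right; rewrite addnS; exists (last (p + q)%N A); split; first exact: mlast.
- by move=> i ip; rewrite /last ifF ?U'N //; lia.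
- move=> i /andP[pi iq]; rewrite /last; case: eqP => [_|neq]; first exact: subsetIr.
  by apply: subset_trans (U'U _ _) (UA _ _); lia.
Qed.

(** * From classes to copies covering [w] *)

Lemma cover_of_nbhd_classes (R : realType) (H : sgraph) (mu eps : R) :
  has_edge H -> 0 < eps -> (chi H).-1%:R * mu + eps <= 1 ->
  exists T n0 : nat, forall G : sgraph, (n0 <= #|G|)%N ->
  forall (w : G) (U : nat -> {set G}),
  multipartite (chi H).-1 T U ->
  (forall i, (i < (chi H).-1)%N -> U i \subset nbhd w) ->
  (forall i x, (i < (chi H).-1)%N -> x \in U i ->
     #|~: nbhd x|%:R <= mu * #|G|%:R) ->
  covering_copy H w.
Proof.
move=> edgeH eps0 mu1; have chi2 := chi_gt1 edgeH.
have [T [n0 ext]] := multipartite_extend (chi H).-1 #|H|.+1 eps0.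
exists T, n0 => G lG w U mU Uw missU.
(* The last class is sought in the whole graph, not only in [nbhd w]. *)
have [| U' [mU' U'U _]] := ext G lG U (fun=> mu) setT mU missU.
  rewrite sumr_const card_ord -[mu *+ _]mulr_natl cardsT.
  by rewrite ler_piMl.
have [x _] := edgeH.
have /colorableP[c [ltc pc]] := colorable_chi H.
(* Transposing the colours [c x] and [(chi H).-1] keeps the neighbours of [x] out of the last
   class. *)
pose c' y := if c y == c x then (chi H).-1
             else if c y == (chi H).-1 then c x else c y.
rewrite prednK in mU'; last lia.
apply: (embed_multipartite (x := x) (c := c') mU').
- by move=> y; rewrite /c'; have := ltc x; have := ltc y;
    case: (c y =P c x); case: (c y =P (chi H).-1); lia.
- move=> y y' /pc; rewrite /c'; case: (c y =P c x); case: (c y' =P c x);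
    case: (c y =P (chi H).-1); case: (c y' =P (chi H).-1);
    have := ltc x; have := ltc y; have := ltc y'; lia.
- move=> y xy.
  have ltc'y : (c' y < (chi H).-1)%N.
    by have := pc x y xy; have := ltc x; have := ltc y;
      rewrite /c'; case: (c y =P c x); case: (c y =P (chi H).-1); lia.
  exact: subset_trans (U'U _ ltc'y) (Uw _ ltc'y).
Qed.

Lemma cover_of_extendable (H G : sgraph) (x : H) (m : nat) (w : G)
    (U : nat -> {set G}) :
  extendable x m -> multipartite (chi H + m) #|H|.+1 U ->
  (forall i, (i < chi H - 2)%N -> U i \subset nbhd w) -> covering_copy H w.
Proof.
case/existsP=> c0 /existsP[c /and3P[_ /forallP pc /forallP cc0]] mU Uw.
apply: (embed_multipartite (x := x) (c := fun y => c y) mU) => //.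
- by move=> y y' yy'; have /forallP/(_ y')/implyP/(_ yy') := pc y.
- move=> y xy; apply: Uw.
  have yN : y \in nbhd x by rewrite inE.
  by have /eqP /= -> := cc0 (Sub y yN).
Qed.

(** * The numbers [CE] and [chi_Ore] *)

Lemma CE_SomeP (H : sgraph) (m : nat) : CE H = Some m ->
  (exists x : H, extendable x m) /\
  (forall x : H, (chi (induced (nbhd x)) + 2 <= chi H)%N ->
     forall m', extendable x m' -> (m <= m')%N).
Proof.
rewrite /CE; case: pickP => // x0 _ [<-]; split.
  exists (val [arg min_(x < x0) ext_number x]).
  by rewrite [X in extendable _ X]/ext_number; case: ex_minnP.
move=> x lowx m' ext.
case: arg_minnP => // x1 _ /(_ (Sub x lowx) isT) /leq_trans; apply.
by rewrite /ext_number; case: ex_minnP => k _; apply.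
Qed.

Lemma CE_NoneP (H : sgraph) : CE H = None ->
  forall x : H, (chi H <= chi (induced (nbhd x)) + 1)%N.
Proof.
rewrite /CE; case: pickP => // noL _ x; rewrite leqNgt; apply/negP => lowx.
have lowx' : (chi (induced (nbhd x)) + 2 <= chi H)%N by lia.
by have := noL (Sub x lowx').
Qed.

(** Write [r] for [chi H] and [c] for the inverse. The finite case is equivalent to
    [(r - 2) c + (m + 1) (r c - 1) = 1]: the relative part sizes of the extremal graph add up to
    1. *)
Lemma chi_Ore_inv (R : realType) (H : sgraph) :
  (1 < chi H)%N ->
  [/\ 0 < (chi_Ore R H)^-1, (chi H).-1%:R * (chi_Ore R H)^-1 <= 1 &
    if CE H is Some m
    then (m%:R + 2) * ((chi H)%:R * (chi_Ore R H)^-1 - 1) = 2 * (chi_Ore R H)^-1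
    else (chi H)%:R * (chi_Ore R H)^-1 = 1].
Proof.
move=> chi2; have chiP : (chi H)%:R = (chi H).-1%:R + 1 :> R.
  by rewrite natr1 prednK //; lia.
have pred1 : 1 <= (chi H).-1%:R :> R by rewrite ler1n; lia.
have [chi0 ge_pred eqE] : [/\ 0 < chi_Ore R H, (chi H).-1%:R <= chi_Ore R H &
    if CE H is Some m then (m%:R + 2) * ((chi H)%:R - chi_Ore R H) = 2
    else chi_Ore R H = (chi H)%:R].
  rewrite /chi_Ore; case: CE => [m|]; last by split=> //; lra.
  have m0 : 0 <= m%:R :> R by [].
  have le1 : 2 / (m%:R + 2) <= 1 :> R by rewrite ler_pdivrMr; lra.
  by split; [lra | lra | field; lra].
have nz : chi_Ore R H != 0 by rewrite gt_eqF.
split; first by rewrite invr_gt0.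
  by rewrite ler_pdivrMr // mul1r.
case: (CE H) eqE => [m eqE|->]; last by rewrite divff // gt_eqF //; lra.
apply: (mulIf nz); rewrite -mulrA mulrBl divfK // mul1r eqE.
by rewrite -mulrA mulVf ?mulr1.
Qed.

(** * The upper bound *)

Lemma cardC_nbhd (R : realType) (G : sgraph) (x : G) :
  #|~: nbhd x|%:R = #|G|%:R - (deg x)%:R :> R.
Proof. by rewrite -(cardsC (nbhd x)) natrD addrC addKr. Qed.

Lemma deg_lt_card (G : sgraph) (x : G) : (deg x < #|G|)%N.
Proof.
rewrite -cardsT; apply: proper_card; apply/properP; split; first exact: subsetT.
by exists x; rewrite !inE ?edge_irr.
Qed.

(** For [eta = 0] the left side is at most 1, with equality at [a = m + 1]. For [a >= 1] the gain
    [a * (r * eta - eta / 2)] exceeds the error [eta / 2]; for [a = 0] the bound [(r - 1) * c <= 1]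
    suffices. *)
Lemma alternative_bound (R : realType) (r c eta m a : R) :
  2 <= r -> 0 < eta -> eta <= c -> (r - 1) * c <= 1 -> 0 <= m ->
  (m + 2) * (r * c - 1) = 2 * c -> a = 0 \/ 1 <= a <= m + 1 ->
  (r - 2) * (c - eta) + a * (r * (c - eta) - 1 + 2 * (eta / 4)) + 2 * (eta / 4)
    <= 1.
Proof.
move=> r2 eta0 etac rc1 m0 CEc; have r2eta : 0 <= (r - 2) * eta by apply: mulr_ge0; lra.
case=> [->|/andP[a1 am]]; first lra.
have rc_ge1 : 0 <= r * c - 1.
  by rewrite -(pmulr_rge0 _ (_ : 0 < m + 2)) ?CEc; lra.
have : a * (r * c - 1) <= (m + 1) * (r * c - 1) by rewrite ler_wpM2r.
have : 3 / 2 * eta <= a * (r * eta - eta / 2).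
  apply: (@le_trans _ _ (1 * (r * eta - eta / 2))); first lra.
  by rewrite ler_wpM2r //; lra.
by lra.
Qed.

Lemma Ore_cover (R : realType) (H : sgraph) (eta : R) :
  has_edge H -> 0 < eta -> eta <= (chi_Ore R H)^-1 ->
  exists n0 : nat, forall G : sgraph, (n0 <= #|G|)%N -> forall w : G,
  (forall x y : G, x != y -> ~~ edge x y ->
     2 * (1 - (chi_Ore R H)^-1 + eta) * #|G|%:R <= (deg x)%:R + (deg y)%:R) ->
  covering_copy H w.
Proof.
move=> edgeH eta0; have chi2 := chi_gt1 edgeH.
have le_r2 i : (i < (chi H).-1)%N -> (i <= chi H - 2)%N by lia.
have le_r3 i : (i < chi H - 2)%N -> (i <= chi H - 3)%N by lia.
have ge_r3 i : (i < chi H - 2)%N -> (3 <= chi H)%N by lia.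
have predr : (chi H).-1 = (chi H - 2).+1 by lia.
have [] := chi_Ore_inv R chi2; move: (_^-1) => c c0 rc1 CEc eta_c.
have [h _] := edgeH.
pose eps := eta / 4; have eps0 : 0 < eps by rewrite divr_gt0.
have rE : (chi H).-1%:R = (chi H)%:R - 1 :> R by rewrite -subn1 natrB //; lia.
have r2E : (chi H - 2)%:R = (chi H)%:R - 2 :> R by rewrite natrB.
have r2 : 2 <= (chi H)%:R :> R by rewrite ler_nat.
set r : R := (chi H)%:R in rE r2E r2 CEc *.
have r2eta : 0 <= (r - 2) * eta by apply: mulr_ge0; lra.
have mu_nat (k l : nat) : (k <= l)%N -> k%:R * (c - eta) <= l%:R * (c - eta).
  by move=> kl; rewrite ler_wpM2r ?ler_nat //; lra.
have [||T [n1 finish]] := @cover_of_nbhd_classes R H (c - eta) eps edgeH.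
- by [].
- have : eta <= r * eta - eta by nra.
  by rewrite rE in rc1 *; rewrite /eps; lra.
have [n2 within] := multipartite_within (c - eta) (chi H).-1 T eps0.
(* [r - 2] classes in [nbhd w] and [m + 2] others make [r + m]. *)
pose q := if CE H is Some m then (m + 2)%N else 0%N.
(* With [K] and [thr] as below, the second rate comes from [#|G| - (2 K - thr)]: if [deg w < thr], a
   non-neighbour of [w] has degree above [2 K - thr]. *)
have [n3 alt] := multipartite_alternative (c - eta)
  (r * (c - eta) - 1 + 2 * eps) (chi H - 2) q (T + #|H|.+1) eps0.
pose n4 := (Num.truncn (#|H|.+1%:R / eps)).+1.
exists (maxn (maxn (maxn n1 n2) (maxn n3 n4)) (#|H| + 2)) => G.
rewrite !geq_max => /andP[/andP[/andP[lG1 lG2] /andP[lG3 lG4]] lG5] w ore.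
have n_eps : #|H|%:R + 1 < eps * #|G|%:R.
  have : #|H|.+1%:R / eps < #|G|%:R.
    by apply: lt_le_trans (truncnS_gt _) _; rewrite ler_nat.
  by rewrite ltr_pdivrMr // natr1 mulrC.
pose K : R := (1 - c + eta) * #|G|%:R.
have {}ore (x y : G) : x != y -> ~~ edge x y -> 2 * K <= (deg x)%:R + (deg y)%:R.
  by move=> xy exy; rewrite /K mulrA; exact: ore xy exy.
pose L := [set x : G | (deg x)%:R < K].
have cliqueL (x y : G) : x \in L -> y \in L -> x != y -> edge x y.
  rewrite !inE => xL yL xy; apply: contraT => exy.
  by have := ore x y xy exy; lra.
have [leHL|ltLH] := leqP #|H| #|nbhd w :&: L|.
  apply: (embed_clique h leHL (subsetIl _ _)) => x y.
  by rewrite !inE => /andP[_ xL] /andP[_ yL]; apply: cliqueL; rewrite inE.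
pose N := nbhd w :\: L.
have missN x : x \in N -> #|~: nbhd x|%:R <= (c - eta) * #|G|%:R.
  rewrite cardC_nbhd !inE -leNgt => /andP[degx _].
  by move: degx; rewrite /K; lra.
have cardN : (deg w)%:R - #|H|%:R <= #|N|%:R :> R.
  have ltLHR : #|nbhd w :&: L|%:R < #|H|%:R :> R by rewrite ltr_nat.
  have /(congr1 (fun k => k%:R : R)) := cardsID L (nbhd w).
  by rewrite natrD -/N -/(deg w); lra.
have n0 : 0 <= #|G|%:R :> R by [].
have Nw i (U : nat -> {set G}) : U i \subset N -> U i \subset nbhd w.
  by move=> UN; apply: subset_trans UN (subsetDl _ _).
have finishN U : multipartite (chi H).-1 T U ->
    (forall i, (i < (chi H).-1)%N -> U i \subset N) -> covering_copy H w.
  move=> mU UN; apply: (finish G lG1 w U mU).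
    by move=> i ir; apply/Nw/UN.
  by move=> i x ir xU; apply: missN; apply: subsetP (UN i ir) _ xU.
(* From this degree on, [r - 1] classes fit into [N]; one [eps] pays for the vertices lost with
   [L]. *)
pose thr := ((r - 2) * (c - eta) + 2 * eps) * #|G|%:R.
have high : thr <= (deg w)%:R -> covering_copy H w.
  move=> deg_high; have [|U [mU UN]] := within G lG2 N missN.
    move=> i ir; apply: le_trans cardN.
    have : (i%:R * (c - eta)) * #|G|%:R <= (r - 2) * (c - eta) * #|G|%:R.
      by rewrite ler_wpM2r // -r2E mu_nat // le_r2.
    by move: deg_high; rewrite /thr; lra.
  exact: finishN mU UN.
have [degA|degB] := leP K (deg w)%:R.
  apply: high; apply: le_trans degA; rewrite /K /thr ler_wpM2r //.
  by rewrite rE in rc1; rewrite /eps; lra.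
have wL : w \in L by rewrite inE.
have Lw x : x \in L -> x != w -> x \in nbhd w.
  by move=> xL xw; rewrite inE; apply: cliqueL; rewrite // eq_sym.
(* Otherwise [deg w = #|G| - 1 < K], so [L] is everything and contains more than [#|H|] neighbours
   of [w]. *)
have nonnb : exists2 y, y != w & ~~ edge w y.
  apply/exists_inP; apply: contraT; rewrite negb_exists_in => /forall_inP all_nb.
  have nbE : nbhd w = ~: [set w].
    apply/setP=> y; rewrite !inE; case: (eqVneq y w) => [->|yw]; first by rewrite edge_irr.
    by have := all_nb y yw; rewrite negbK.
  have degw : (deg w)%:R = #|G|%:R - 1 :> R.
    by rewrite /deg nbE -(cardsC [set w]) natrD cards1 addrC addKr.
  have LT : L = setT.
    apply/setP=> y; rewrite !inE; apply: le_lt_trans degB.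
    by rewrite degw lerBrDr natr1 ler_nat deg_lt_card.
  move: ltLH; rewrite LT setIT -(ltr_nat R) -/(deg w) degw.
  have : (#|H| + 2)%:R <= #|G|%:R :> R by rewrite ler_nat.
  by rewrite natrD; lra.
have deg_low : (1 - 2 * c + 2 * eta) * #|G|%:R <= (deg w)%:R.
  have [y yw wy] := nonnb; have := ore w y; rewrite eq_sym => /(_ yw wy).
  have : (deg y)%:R < #|G|%:R :> R by rewrite ltr_nat deg_lt_card.
  by rewrite /K; lra.
have [|deg_thr] := leP thr (deg w)%:R; first exact: high.
case EqCE: (CE H) CEc => [m|] CEc; last first.
  (* For infinite [CE], [r c = 1] turns [1 - 2 c] into [(r - 2) c]. *)
  apply: high; apply: le_trans deg_low; rewrite /thr ler_wpM2r //.
  by rewrite /eps; lra.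
have [[x ext] _] := CE_SomeP EqCE.
pose A := ~: nbhd w :\ w.
have missA y : y \in A ->
    #|~: nbhd y|%:R <= (r * (c - eta) - 1 + 2 * eps) * #|G|%:R.
  rewrite cardC_nbhd !inE => /andP[yw wy].
  have := ore w y; rewrite eq_sym => /(_ yw wy).
  by move: deg_thr; rewrite /thr /K; lra.
(* The clique [L] contains [w], so its other members are neighbours of [w]; only [w] and
   [nbhd w :&: L] are left out. *)
have cardNA : #|G|%:R - (#|H|%:R + 1) <= #|N :|: A|%:R :> R.
  have -> : N :|: A = ~: (w |: (nbhd w :&: L)).
    apply/setP=> y; rewrite in_setU in_setD in_setC in_setU1 in_setI in_setD1 in_setC.
    case: (eqVneq y w) => [->|yw] /=; first by rewrite wL.
    by case: (boolP (y \in L)) => [/Lw/(_ yw) ->|_] //=; rewrite ?andbF ?orbN.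
  have /(congr1 (fun k => k%:R : R)) := cardsC (w |: (nbhd w :&: L)).
  rewrite natrD cardsU1 => /esym ->; rewrite natrD.
  have : (w \notin nbhd w :&: L)%:R <= 1 :> R by case: (_ \notin _).
  have : #|nbhd w :&: L|%:R < #|H|%:R :> R by rewrite ltr_nat.
  by lra.
have [||[U [mU UN]]|[U [mU UN UA]]] := alt G lG3 N A missN missA.
(* Here [i <= r - 3], and [(r - 3) c <= 1 - 2 c], so [deg_low] suffices. *)
- move=> i ir; apply: le_trans cardN.
  have r3 : 3 <= r by rewrite /r ler_nat (ge_r3 i).
  have : i%:R * (c - eta) <= (r - 3) * (c - eta).
    by rewrite /r -natrB ?(ge_r3 i) // mu_nat // le_r3.
  have : 0 <= (r - 3) * eta by apply: mulr_ge0; lra.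
  move=> h1 h2; have : (i%:R * (c - eta) + 2 * eps) * #|G|%:R <= (1 - 2 * c + 2 * eta) * #|G|%:R.
    by rewrite ler_wpM2r // /eps; rewrite rE in rc1; lra.
  by lra.
- move=> i; rewrite /q EqCE => im; apply: le_trans cardNA.
  suff : ((r - 2) * (c - eta) + i%:R * (r * (c - eta) - 1 + 2 * eps) + 2 * eps)
      * #|G|%:R <= 1 * #|G|%:R by rewrite r2E; lra.
  rewrite ler_wpM2r // /eps; apply: (@alternative_bound _ _ _ _ m%:R) => //.
    by move: rc1; rewrite rE.
  case: i im => [|i] im; [by left | right].
  by rewrite addn2 ltnS in im; rewrite ler1n natr1 ler_nat.
- apply: (finishN U); last by rewrite predr.
  by rewrite predr; apply: multipartite_weaken mU; rewrite ?leq_addr.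
- apply: (cover_of_extendable (m := m) (U := U) ext); last by move=> i ir; apply/Nw/UN.
  by apply: multipartite_weaken mU; rewrite ?leq_addl // /q EqCE addnCA subnK // addnC.
Qed.

(** * The extremal graph *)

Lemma card_interval_ord (n a s : nat) :
  (#|[set i : 'I_n | a <= i < a + s]| <= s)%N.
Proof.
rewrite cardE -(size_map val) -[leqRHS](size_iota a s) uniq_leq_size //.
  by rewrite (map_inj_uniq val_inj) enum_uniq.
by move=> i /mapP[x]; rewrite mem_enum inE mem_iota => ? ->.
Qed.

(** Consecutive blocks: [p] of length [s], then blocks of length [t] numbered from [p] on. *)
Definition part_index (p s t i : nat) : nat :=
  if (i < p * s)%N then (i %/ s)%N else (p + (i - p * s) %/ t)%N.

Lemma part_index_lt (p s t i : nat) :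
  (0 < s)%N -> (part_index p s t i < p)%N = (i < p * s)%N.
Proof.
move=> s0; rewrite /part_index; case: (ltnP i (p * s)) => ips; first by rewrite ltn_divLR.
by apply/negbTE; rewrite -leqNgt leq_addr.
Qed.

Lemma card_part_low (n p s t a : nat) : (0 < s)%N -> (a < p)%N ->
  (#|[set i : 'I_n | part_index p s t i == a]| <= s)%N.
Proof.
move=> s0 ap; apply: leq_trans (card_interval_ord n (a * s) s).
apply: subset_leq_card; apply/subsetP=> i; rewrite !inE => /eqP eqa.
have ips : (i < p * s)%N by rewrite -(part_index_lt p t i s0) eqa.
move: eqa; rewrite /part_index ips => <-.
by rewrite leq_divM -mulSnr ltn_ceil.
Qed.

Lemma card_part_high (n p s t a : nat) : (0 < s)%N -> (0 < t)%N -> (p <= a)%N ->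
  (#|[set i : 'I_n | part_index p s t i == a]| <= t)%N.
Proof.
move=> s0 t0 pa; apply: leq_trans (card_interval_ord n (p * s + (a - p) * t) t).
apply: subset_leq_card; apply/subsetP=> i; rewrite !inE => /eqP eqa.
have ips : (p * s <= i)%N by rewrite leqNgt -(part_index_lt p t i s0) eqa -leqNgt.
move: eqa; rewrite /part_index ltnNge ips /= => <-; rewrite addKn.
have := leq_divM (i - p * s) t; have := ltn_ceil (i - p * s) t0.
by rewrite mulSnr; lia.
Qed.

(* A complete multipartite graph with p parts of size s and all further parts of
   size at most t, in which a vertex w of a further part keeps only its edges to
   the first p parts. *)
Lemma extremal_graph (p q s t n : nat) (k : int) :
  (0 < s)%N -> (0 < t)%N -> (p * s < n)%N -> (n <= p * s + q * t)%N ->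
  k + (2 * s)%:Z <= (2 * n)%:Z ->
  k + t.+1%:Z <= (p * s + n)%:Z ->
  k + (2 * t.+1)%:Z <= (2 * n)%:Z ->
  exists (G : sgraph) (w : G) (g : G -> nat),
  [/\ #|G| = n,
      forall x y : G, x != y -> ~~ edge x y -> k <= (deg x + deg y)%:Z,
      forall x y : G, edge x y -> g x != g y,
      forall x, (g x < p + q)%N &
      forall x, edge w x -> (g x < p)%N].
Proof.
move=> s0 t0 psn nqt k1 k2 k3.
pose g (x : 'I_n) := part_index p s t x.
pose w := Ordinal psn.
have gw : g w = p by rewrite /g /part_index /= ltnn subnn div0n addn0.
pose e (x y : 'I_n) := [&& g x != g y, (x == w) ==> (g y < p)%N & (y == w) ==> (g x < p)%N].
have e_sym : symmetric e by move=> x y; rewrite /e eq_sym; congr (_ && _); rewrite andbC.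
have e_irr : irreflexive e by move=> x; rewrite /e eqxx.
pose G := SGraph e_sym e_irr.
have degw : (deg (w : G) = p * s)%N.
  rewrite /deg.
  have -> : nbhd (w : G) = [set i : 'I_n | (i < p * s)%N].
    apply/setP=> y; rewrite !inE /= /e gw eqxx ltnn implybF /g part_index_lt //.
    rewrite -(part_index_lt p t y s0) eq_sym.
    case: (eqVneq y w) => [->|_]; first by rewrite -/(g w) gw ltnn andbF.
    by rewrite andbT ltn_neqAle -/(g y); case: ltngtP.
  have -> : [set i : 'I_n | (i < p * s)%N] = [set widen_ord (ltnW psn) j | j : 'I_(p * s)].
    apply/setP=> i; rewrite inE; apply/idP/imsetP => [ips|[j _ ->]]; last exact: (ltn_ord j).
    by exists (Ordinal ips) => //; apply: val_inj.
  by rewrite card_imset ?card_ord // => i j /(congr1 val) /= /val_inj.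
have card_other x : (n <= #|[set y : 'I_n | g y != g x]| + #|[set y : 'I_n | g y == g x]|)%N.
  rewrite -[leqLHS]card_ord -(cardsC [set y : 'I_n | g y == g x]) addnC leq_add2r.
  by apply: subset_leq_card; apply/subsetP=> y; rewrite !inE.
have deg_low (x : G) : (g x < p)%N -> (n <= deg x + s)%N.
  move=> gx; apply: leq_trans (card_other x) _; apply: leq_add; last exact: card_part_low.
  apply: subset_leq_card; apply/subsetP=> y; rewrite !inE /= /e eq_sym => ->.
  have -> /= : x == w = false by apply: contraTF gx => /eqP->; rewrite gw ltnn.
  by rewrite gx implybT.
(* The extra 1 is the edge to [w] that [x] may have lost. *)
have deg_high (x : G) : x != w -> (p <= g x)%N -> (n <= deg x + t.+1)%N.
  move=> xw gx; apply: leq_trans (card_other x) _; rewrite addnS -addSn.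
  apply: leq_add; last exact: card_part_high.
  apply: (@leq_trans #|w |: nbhd x|); last by rewrite cardsU1; case: (_ \notin _).
  apply: subset_leq_card; apply/subsetP=> y; rewrite !inE /= /e eq_sym (negPf xw) => ->.
  by case: (y == w).
exists G, w, g; split=> [|x y xy|x y|x|x].
- exact: card_ord.
(* [k1] serves two vertices of the first [p] parts, [k2] the vertex [w] with another of the further
   parts, [k3] two further vertices other than [w]. Mixed pairs are adjacent. *)
- rewrite /= /e; case: (ltnP (g x) p) => gx; case: (ltnP (g y) p) => gy /=.
  + by move=> _; have := deg_low x gx; have := deg_low y gy; lia.
  + rewrite implybT andbT.
    have -> /= : x == w = false by apply: contraTF gx => /eqP->; rewrite gw ltnn.
    by rewrite andbT negbK => /eqP; lia.
  + rewrite implybT /=.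
    have -> /= : y == w = false by apply: contraTF gy => /eqP->; rewrite gw ltnn.
    by rewrite andbT negbK => /eqP; lia.
  + move=> _; case: (eqVneq x w) => [xw|xw].
      by have := deg_high y; rewrite -{1}xw eq_sym => /(_ xy gy); rewrite xw degw; lia.
    case: (eqVneq y w) => [yw|yw]; first by have := deg_high x xw gx; rewrite yw degw; lia.
    by have := deg_high x xw gx; have := deg_high y yw gy; lia.
- by case/and3P.
- rewrite /g /part_index; case: (ltnP x (p * s)) => xps; first by rewrite ltn_addr // ltn_divLR.
  by rewrite ltn_add2l ltn_divLR //; have := ltn_ord x; lia.
- by case/and3P; rewrite eqxx.
Qed.

(** * The lower bound *)

Lemma chi_induced_leq (H : sgraph) (x : H) (c : H -> nat) (k : nat) :
  (forall y y' : H, edge y y' -> c y != c y') ->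
  (forall y, edge x y -> (c y < k)%N) -> (chi (induced (nbhd x)) <= k)%N.
Proof.
move=> pc ltc; apply: chi_leq; apply/colorableP; exists (fun y => c (val y)).
by split=> [[y yx]|y y' /pc] //=; apply: ltc; move: yx; rewrite inE.
Qed.

Lemma extendable_of_coloring (H : sgraph) (x : H) (c : H -> nat) (m : nat) :
  (forall y, (c y < chi H + m)%N) ->
  (forall y y' : H, edge y y' -> c y != c y') ->
  (forall y, edge x y -> (c y < chi H - 2)%N) -> extendable x m.
Proof.
move=> ltc pc ltxc.
have ltc0 (y : induced (nbhd x)) : (c (val y) < chi H - 2)%N.
  by apply: ltxc; have := valP y; rewrite inE.
apply/existsP; exists [ffun y => Ordinal (ltc0 y)].
apply/existsP; exists [ffun y => Ordinal (ltc y)]; apply/and3P; split.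
- apply/forallP=> y; apply/forallP=> y'; apply/implyP=> yy'.
  by rewrite !ffunE -val_eqE /= pc.
- apply/forallP=> y; apply/forallP=> y'; apply/implyP=> yy'.
  by rewrite !ffunE -val_eqE /= pc.
- by apply/forallP=> y; rewrite !ffunE.
Qed.

(** A copy with [x] at [w] pulls [g] back to a colouring of [H] with [r - 2] colours on [nbhd x].
    This is impossible for infinite [CE]; otherwise it uses [r + m - 1] colours, against the
    minimality of [m], or of [chi H] if [m = 0]. *)
Lemma no_cover_of_coloring (H G : sgraph) (w : G) (g : G -> nat) (q : nat) :
  has_edge H -> (forall x y : G, edge x y -> g x != g y) ->
  (forall x, (g x < chi H - 2 + q)%N) ->
  (forall x, edge w x -> (g x < chi H - 2)%N) ->
  (if CE H is Some m then q = m.+1 else True) -> ~ covering_copy H w.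
Proof.
move=> edgeH pg ltg ltgw qCE [f [_ edgef [x fx]]]; have chi2 := chi_gt1 edgeH.
pose c y := g (f y).
have pc (y y' : H) : edge y y' -> c y != c y' by move=> /edgef /pg.
have ltcx y : edge x y -> (c y < chi H - 2)%N.
  by move=> /edgef; rewrite fx => /ltgw.
have lowx := chi_induced_leq pc ltcx.
case EqCE: (CE H) qCE => [m|]; last by have := CE_NoneP EqCE x; lia.
have [_ minm] := CE_SomeP EqCE.
case: m minm {EqCE} => [|m] minm qE.
  have : (chi H <= (chi H).-1)%N; last lia.
  apply: chi_leq; apply/colorableP; exists c; split=> // y.
  by have := ltg (f y); rewrite /c qE; lia.
have : (m.+1 <= m)%N; last by rewrite ltnn.
apply: (minm x); first lia.
apply: (extendable_of_coloring (c := c)) => // y.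
by have := ltg (f y); rewrite /c qE; lia.
Qed.

Lemma Ore_forces_lower (R : realType) (H : sgraph) : has_edge H ->
  exists n0 : nat, forall n : nat, (n0 <= n)%N -> forall k : int,
  Ore_forces H n k ->
  2 * (1 - (chi_Ore R H)^-1) * n%:R - (2 * (chi H)%:R + 4) <= k%:~R.
Proof.
move=> edgeH; have chi2 := chi_gt1 edgeH.
have [] := chi_Ore_inv R chi2; move: (_^-1) => c c0 rc1 CEc.
have pE : (chi H)%:R = (chi H - 2)%:R + 2 :> R by rewrite -natrD subnK.
have rE : (chi H).-1%:R = (chi H)%:R - 1 :> R by rewrite -subn1 natrB //; lia.
rewrite {}rE in rc1; move: CEc rc1; rewrite pE; set p := (chi H - 2)%N => CEc rc1.
have p0 : 0 <= p%:R :> R by [].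
have p_eq : chi H = (p + 2)%N by rewrite subnK.
exists (Num.truncn c^-1).+1 => n ln k force.
rewrite leNgt; apply/negP => ltk.
have n1 : 1 < c * n%:R.
  rewrite -ltr_pdivrMl // mulr1; apply: lt_le_trans (truncnS_gt _) _.
  by rewrite ler_nat.
have n0 : 0 < n%:R :> R by rewrite -(pmulr_rgt0 _ c0); lra.
pose s := Num.truncn (c * n%:R).
have [s_le s_gt] : s%:R <= c * n%:R /\ c * n%:R < s%:R + 1.
  by have /andP[] := truncn_itv (ltW (lt_trans ltr01 n1)); rewrite -natr1.
have s0 : (0 < s)%N by rewrite -(ltr_nat R); lra.
have ps_le : p%:R * s%:R <= p%:R * (c * n%:R) by rewrite ler_wpM2l.
have ps_ge : p%:R * (c * n%:R) <= p%:R * s%:R + p%:R.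
  have : p%:R * (c * n%:R) <= p%:R * (s%:R + 1) by rewrite ler_wpM2l // ltW.
  by lra.
have rc1n : (p%:R + 1) * c * n%:R <= n%:R by apply: ler_piMl; lra.
have psn : (p * s < n)%N by rewrite -(ltr_nat R) natrM; lra.
(* The remaining vertices form [m + 1] nearly equal parts, or singletons for infinite [CE]. By
   [(r - 2) c + (m + 1) (r c - 1) = 1] they have size about [(r c - 1) n]; [p + 1] absorbs
   rounding. *)
have [q [t [t0 nqt qCE t_le]]] : exists q t : nat,
    [/\ (0 < t)%N, (n <= p * s + q * t)%N,
        if CE H is Some m then q = m.+1 else True &
        t%:R <= ((p%:R + 2) * c - 1) * n%:R + p%:R + 1].
  case EqCE: (CE H) CEc => [m|] CEc; last first.
    exists n, 1%N; split=> //; first by rewrite muln1 leq_addl.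
    by rewrite CEc; lra.
  exists m.+1, ((n - p * s) %/ m.+1).+1; split=> //.
    by rewrite -leq_subLR [(m.+1 * _)%N]mulnC ltnW // ltn_ceil.
  have m1 : 0 < m.+1%:R :> R by rewrite ltr0n.
  rewrite -natr1 lerD2r; move: (leq_divM (n - p * s) m.+1).
  rewrite -(ler_nat R) natrM natrB ?(ltnW psn) // natrM.
  move: (_ %/ _)%N => d dle; rewrite -(ler_pM2r m1).
  apply: le_trans dle _; move: m1 CEc; rewrite -natr1.
  have m0 : 0 <= m%:R :> R by []; move: (m%:R) m0 => M M0 _ CEc.
  have -> : (((p%:R + 2) * c - 1) * n%:R + p%:R) * (M + 1) =
    ((M + 2) * ((p%:R + 2) * c - 1) - ((p%:R + 2) * c - 1)) * n%:R + p%:R + M * p%:R.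
    by ring.
  have : 0 <= M * p%:R by apply: mulr_ge0.
  by rewrite CEc; lra.
(* Up to constants, the first two degree sums are [2 (1 - c) n]; the third is [2 (2 - r c) n], no
   smaller since [(r - 1) c <= 1]. *)
have [||| G [w [g [cardG ore pg ltg ltgw]]]] :=
    @extremal_graph p q s t n k s0 t0 psn nqt.
- rewrite -(ler_int R) rmorphD /= -!pmulrn natrM; rewrite natrM; lra.
- by rewrite -(ler_int R) rmorphD /= -!pmulrn -natr1 natrD natrM; lra.
- by rewrite -(ler_int R) rmorphD /= -!pmulrn natrM -natr1 natrM; lra.
apply: (no_cover_of_coloring edgeH pg ltg ltgw qCE).
exact: force.
Qed.

(** * The threshold and its two bounds *)

Lemma Ore_forces_upper (R : realType) (H : sgraph) (eta : R) :
  has_edge H -> 0 < eta ->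
  exists n0 : nat, forall n : nat, (n0 <= n)%N -> forall k : int,
  2 * (1 - (chi_Ore R H)^-1 + eta) * n%:R <= k%:~R -> Ore_forces H n k.
Proof.
move=> edgeH eta0; have [c0 _ _] := chi_Ore_inv R (chi_gt1 edgeH).
(* [Ore_cover] asks for [eta] at most the inverse; a smaller [eta] only weakens the degree
   condition. *)
pose eta' := Num.min eta (chi_Ore R H)^-1.
have [| |n0 cover] := @Ore_cover R H eta' edgeH.
- by rewrite lt_min eta0.
- by rewrite ge_min lexx orbT.
exists n0 => n ln k kge G w Gn ore; apply: cover; first by rewrite Gn.
move=> x y xy exy; have := ore x y xy exy; rewrite -(ler_int R) -pmulrn natrD.
apply: le_trans; apply: le_trans kge; rewrite Gn ler_wpM2r // ler_pM2l //.
by rewrite lerD2l ge_min lexx.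
Qed.

Lemma least_int (P : int -> Prop) (b k : int) : P k ->
  (forall j, P j -> b <= j) -> exists l, P l /\ forall j, P j -> l <= j.
Proof.
move=> Pk lb; have natb j : P j -> exists2 i : nat, `[<P (b + i%:Z)>] & j = b + i%:Z.
  move=> Pj; have bj := lb j Pj; exists `|j - b|%N; last by lia.
  by apply/asboolP; have -> : b + `|j - b|%N%:Z = j by lia.
have [i Pi _] := natb k Pk.
have exP : exists i : nat, `[<P (b + i%:Z)>] by exists i.
case: (ex_minnP exP) => l /asboolP Pl minl; exists (b + l%:Z); split=> // j /natb[i' Pi' ->].
by have := minl i' Pi'; lia.
Qed.

Theorem theorem5 (R : realType) (H : sgraph) (edgeH : has_edge H) :
  exists C : R, forall eta : R, 0 < eta ->
    exists n0 : nat, forall n : nat, (n0 <= n)%N ->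
      exists k : int,
        [/\ is_delta_Ore H n k,
            2 * (1 - (chi_Ore R H)^-1) * n%:R - C <= k%:~R
          & k%:~R <= 2 * (1 - (chi_Ore R H)^-1 + eta) * n%:R].
Proof.
exists (2 * (chi H)%:R + 4) => eta eta0.
(* The other half of [eta] covers the rounding in [k0], as [eta n > 1]. *)
have eta2 : 0 < eta / 2 by rewrite divr_gt0.
have [n1 upper] := Ore_forces_upper edgeH eta2.
have [n2 lower] := Ore_forces_lower R edgeH.
exists (maxn (maxn n1 n2) (Num.truncn eta^-1).+1) => n.
rewrite !geq_max => /andP[/andP[ln1 ln2] ln3].
pose k0 : int := Num.floor (2 * (1 - (chi_Ore R H)^-1 + eta) * n%:R).
have /andP[k0_le k0_gt] := floor_itv (2 * (1 - (chi_Ore R H)^-1 + eta) * n%:R).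
rewrite -/k0 in k0_le k0_gt.
have eta_n : 1 < eta * n%:R.
  rewrite -ltr_pdivrMl // mulr1; apply: lt_le_trans (truncnS_gt _) _.
  by rewrite ler_nat.
have force0 : Ore_forces H n k0.
  by apply: upper => //; move: k0_gt; rewrite rmorphD /=; lra.
(* The main term of [lower] is nonnegative, so every forcing integer is at least a constant and a
   least one exists. *)
have [|k [forcek mink]] := @least_int (Ore_forces H n) (- (2 * (chi H) + 4)%:Z) k0 force0.
  move=> j /(lower n ln2); rewrite -(ler_int R) rmorphN /= -pmulrn natrD natrM.
  have : 0 <= 2 * (1 - (chi_Ore R H)^-1) * n%:R.
    have [c0 rc1 _] := chi_Ore_inv R (chi_gt1 edgeH).
    rewrite !mulr_ge0 // subr_ge0; apply: le_trans rc1.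
    by rewrite ler_peMl ?(ltW c0) // ler1n; have := chi_gt1 edgeH; lia.
  by lra.
exists k; split; [by split | exact: lower|].
by apply: le_trans k0_le; rewrite ler_int mink.
Qed.
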